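(* Let $k$ be a non-negative integer. Let $\mu_0,\mu_1,\mu_2,\mu_4$ denote the probability distributions \[\mu_0=\delta_2,\quad \mu_1=\tfrac18\delta_{-2}+\tfrac34\delta_0+\tfrac18\delta_2,\quad \mu_2=\tfrac12\delta_0+\tfrac12\delta_2,\quad \mu_4=\tfrac12\delta_{-2}+\tfrac12\delta_2 .\] Then for all $a\in\{-1,1\}$ and all $\lambda\in\mathbb{C}$ with $|\lambda|=1$, the element $\chi\left((\mathfrak{X}_{a,\lambda})^k\right)$ of $\mathcal{A}$ is self-adjoint and admits $\mu_\kappa$ as $*$-distribution (with respect to the Haar state $h$), where \[\kappa=\begin{cases}1&\text{if }k\equiv 1 \pmod 2\\ 2&\text{if }k\equiv 2\pmod 4\\ 4&\text{if }k\equiv 4\pmod 8\\ 0&\text{if }k\equiv 0\pmod 8.\end{cases}\] Moreover, \[\chi\left((\mathfrak{X}_{a,\lambda})^k\right)=\begin{cases}2\dotplus 0\dotplus 0\dotplus -2\dotplus 0_2&\text{if }k\equiv 1\pmod 2\\ 2\dotplus 2\dotplus 2\dotplus 2\dotplus 0_2&\text{if }k\equiv 2\pmod 4\\ 2\dotplus 2\dotplus 2\dotplus 2\dotplus (-2I_2)&\text{if }k\equiv 4\pmod 8\\ 2\dotplus 2\dotplus 2\dotplus 2\dotplus 2I_2&\text{if }k\equiv 0\pmod 8,\end{cases}\] where $0_2$ and $I_2$ are the zero and identity matrices of $\mathcal{M}_2(\mathbb{C})$.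
   Context: $\mathcal{A}=\mathbb{C}\oplus\mathbb{C}\oplus\mathbb{C}\oplus\mathbb{C}\oplus\mathcal{M}_2(\mathbb{C})$ is the multi-matrix $*$-algebra (usual componentwise multiplication and involution) underlying the Kac-Paljutkin finite quantum group $\mathbb{KP}$. Its elements are written $x_1\dotplus x_2\dotplus x_3\dotplus x_4\dotplus C$ with $x_i\in\mathbb{C}$, $C=(c_{ij})\in\mathcal{M}_2(\mathbb{C})$. The Haar state of $\mathbb{KP}$ is \[h(x_1\dotplus x_2\dotplus x_3\dotplus x_4\dotplus C)=\tfrac18\left(x_1+x_2+x_3+x_4+2(c_{11}+c_{22})\right).\] For $a\in\{-1,1\}$ and $\lambda\in\mathbb{C}$, $|\lambda|=1$, and with $\imath$ the imaginary unit, $\mathfrak{X}_{a,\lambda}\in\mathcal{M}_2(\mathcal{A})$ is the $2\times 2$ matrix with entries \[\mathfrak{X}_{(11)}=1\dotplus a\dotplus -a\dotplus -1\dotplus\begin{pmatrix}0&0\\0&0\end{pmatrix},\quad \mathfrak{X}_{(12)}=0\dotplus0\dotplus0\dotplus0\dotplus\begin{pmatrix}0&\lambda\\ \imath a\lambda&0\end{pmatrix},\] \[\mathfrak{X}_{(21)}=0\dotplus0\dotplus0\dotplus0\dotplus\begin{pmatrix}0&\bar\lambda\\ -\imath a\bar\lambda&0\end{pmatrix},\quad \mathfrak{X}_{(22)}=1\dotplus -a\dotplus a\dotplus -1\dotplus\begin{pmatrix}0&0\\0&0\end{pmatrix}.\] Powers are taken in the algebra $\mathcal{M}_2(\mathcal{A})$.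 For a matrix $M$ with entries in $\mathcal{A}$, $\chi(M)=\sum_i M_{ii}\in\mathcal{A}$. A self-adjoint $x\in\mathcal{A}$ admits the probability measure $\mu$ on $\mathbb{R}$ as $*$-distribution if $h(x^m)=\int t^m\,d\mu(t)$ for all integers $m\ge 0$. $\delta_x$ is the Dirac mass at $x$. *)

(* Defs.v *)
From HB Require Import structures.
From mathcomp Require Import all_boot all_order all_algebra.
From mathcomp Require Import all_classical all_reals all_analysis.
From mathcomp Require Import complex ring lra.

Set Implicit Arguments.
Unset Strict Implicit.
Unset Printing Implicit Defensive.

Import Order.TTheory GRing.Theory Num.Theory.

Local Open Scope ring_scope.
Local Open Scope complex_scope.

(* The algebra C + C + C + C + M_2(C), where C is R[i]: the library's product
   ring structure is the componentwise one. The element written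
   x1 ∔ x2 ∔ x3 ∔ x4 ∔ c is the tuple (x1, x2, x3, x4, c). *)
Notation KPalg R := (R[i] * R[i] * R[i] * R[i] * 'M[R[i]]_2)%type.

Definition mx2 (T : Type) (c11 c12 c21 c22 : T) : 'M[T]_2 :=
  \matrix_(i < 2, j < 2)
    (if i == 0 then (if j == 0 then c11 else c12)
     else (if j == 0 then c21 else c22)).

Definition KPstar (R : realType) (x : KPalg R) : KPalg R :=
  let: (x1, x2, x3, x4, c) := x in
  (x1^*, x2^*, x3^*, x4^*, \matrix_(i < 2, j < 2) (c j i)^*).

Definition KPselfadjoint (R : realType) (x : KPalg R) : Prop := KPstar x = x.

Definition haar (R : realType) (x : KPalg R) : R[i] :=
  let: (x1, x2, x3, x4, c) := x in
  8^-1 * (x1 + x2 + x3 + x4 + 2 * (c 0 0 + c 1 1)).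

(* The integrability clause is needed because the library's integral is total. *)
Definition has_star_distribution (R : realType) (x : KPalg R)
    (mu : probability (measurableTypeR R) R) : Prop :=
  forall m : nat,
    mu.-integrable setT (fun t : measurableTypeR R => (t ^+ m)%:E) /\
    haar (x ^+ m) = (\int[mu]_(t in setT) (t ^+ m))%:C.

Definition frakX (R : realType) (a lambda : R[i]) : 'M[KPalg R]_2 :=
  mx2
    ((1, a, - a, -1, 0) : KPalg R)
    ((0, 0, 0, 0, mx2 0 lambda ('i * a * lambda) 0) : KPalg R)
    ((0, 0, 0, 0, mx2 0 (lambda^*) (- ('i * a * lambda^*)) 0) : KPalg R)
    ((1, - a, a, -1, 0) : KPalg R).

Section weighted_diracs.
Context d (T : measurableType d) (R : realType).
Variable s : seq (R * T).

Definition weighted_diracs (A : set T) : \bar R :=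
  (\sum_(p <- s) p.1%:E * \d_(p.2) A)%E.

Lemma weighted_diracs0 : weighted_diracs set0 = 0%E.
Proof. by rewrite /weighted_diracs big1// => p _; rewrite dirac0 mule0. Qed.

Lemma weighted_diracsT :
  weighted_diracs setT = (\sum_(p <- s) p.1)%:E.
Proof.
rewrite /weighted_diracs -sumEFin; apply: eq_bigr => p _.
by rewrite diracT mule1.
Qed.

Hypothesis s_ge0 : all (fun p => 0 <= p.1) s.

Lemma weighted_diracs_ge0 (A : set T) : (0 <= weighted_diracs A)%E.
Proof.
rewrite /weighted_diracs big_seq; apply: sume_ge0 => p /(allP s_ge0) p0.
by rewrite mule_ge0// lee_fin.
Qed.

Lemma weighted_diracs_semi_sigma_additive :
  semi_sigma_additive weighted_diracs.
Proof.
rewrite /weighted_diracs.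
elim: s s_ge0 => [_|p l IH /= /andP[p0 l0]].
  have -> : (fun A : set T => \sum_(p <- [::]) p.1%:E * \d_(p.2) A)%E
      = (mzero : {measure set T -> \bar R}).
    by apply/funext => A; rewrite big_nil.
  exact: measure_semi_sigma_additive.
move=> F mF tF mUF; rewrite big_cons.
under eq_fun => n do under eq_bigr => i _ do rewrite big_cons.
have -> : (fun n => \sum_(0 <= i < n) (p.1%:E * \d_(p.2) (F i) +
      \sum_(q <- l) q.1%:E * \d_(q.2) (F i)))%E =
    ((fun n => \sum_(0 <= i < n) p.1%:E * \d_(p.2) (F i)) \+
     (fun n => \sum_(0 <= i < n) \sum_(q <- l) q.1%:E * \d_(q.2) (F i)))%E.
  by apply/funext => n; rewrite -big_split.
apply: cvgeD.
- apply: ge0_adde_def; rewrite inE; first by rewrite mule_ge0// lee_fin.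
  rewrite big_seq; apply: sume_ge0 => q /(allP l0) q0.
  by rewrite mule_ge0// lee_fin.
- exact: (@measure_semi_sigma_additive _ _ _ (mscale (NngNum p0) (dirac p.2))).
- exact: IH.
Qed.

End weighted_diracs.

Section distributions.
Variable R : realType.
Local Notation point := (measurableTypeR R).

Definition mu0 : set point -> \bar R := @dirac _ point 2 R.

HB.instance Definition _ := Probability.on mu0.

Definition mu1 : set point -> \bar R :=
  @weighted_diracs _ point R [:: (8^-1, -2); (3 / 4, 0); (8^-1, 2)].

Let mu1_ge0 : all (fun p : R * point => 0 <= p.1)
  [:: (8^-1, -2); (3 / 4, 0); (8^-1, 2)].
Proof. by rewrite /= ?invr_ge0 ?divr_ge0 ?ler0n. Qed.

HB.instance Definition _ := isMeasure.Build _ _ _ mu1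
  (weighted_diracs0 _) (weighted_diracs_ge0 mu1_ge0)
  (weighted_diracs_semi_sigma_additive mu1_ge0).

Let mu1_setT : mu1 setT = 1%E.
Proof.
by rewrite /mu1 weighted_diracsT !big_cons big_nil /=; congr EFin; lra.
Qed.

HB.instance Definition _ := @Measure_isProbability.Build _ _ R mu1 mu1_setT.

Definition mu2 : set point -> \bar R :=
  @weighted_diracs _ point R [:: (2^-1, 0); (2^-1, 2)].

Let mu2_ge0 : all (fun p : R * point => 0 <= p.1)
  [:: (2^-1, 0); (2^-1, 2)].
Proof. by rewrite /= ?invr_ge0 ?divr_ge0 ?ler0n. Qed.

HB.instance Definition _ := isMeasure.Build _ _ _ mu2
  (weighted_diracs0 _) (weighted_diracs_ge0 mu2_ge0)
  (weighted_diracs_semi_sigma_additive mu2_ge0).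

Let mu2_setT : mu2 setT = 1%E.
Proof.
by rewrite /mu2 weighted_diracsT !big_cons big_nil /=; congr EFin; lra.
Qed.

HB.instance Definition _ := @Measure_isProbability.Build _ _ R mu2 mu2_setT.

Definition mu4 : set point -> \bar R :=
  @weighted_diracs _ point R [:: (2^-1, -2); (2^-1, 2)].

Let mu4_ge0 : all (fun p : R * point => 0 <= p.1)
  [:: (2^-1, -2); (2^-1, 2)].
Proof. by rewrite /= ?invr_ge0 ?divr_ge0 ?ler0n. Qed.

HB.instance Definition _ := isMeasure.Build _ _ _ mu4
  (weighted_diracs0 _) (weighted_diracs_ge0 mu4_ge0)
  (weighted_diracs_semi_sigma_additive mu4_ge0).

Let mu4_setT : mu4 setT = 1%E.
Proof.
by rewrite /mu4 weighted_diracsT !big_cons big_nil /=; congr EFin; lra.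
Qed.

HB.instance Definition _ := @Measure_isProbability.Build _ _ R mu4 mu4_setT.

End distributions.

Arguments mu0 R : clear implicits.
Arguments mu1 R : clear implicits.
Arguments mu2 R : clear implicits.
Arguments mu4 R : clear implicits.

(* Main.v *)
Require Import Defs.
From HB Require Import structures.
From mathcomp Require Import all_boot all_order all_algebra.
From mathcomp Require Import all_classical all_reals all_analysis.
From mathcomp Require Import complex.
From mathcomp Require Import measurable_realfun zify ring lra.

Local Open Scope ring_scope.
Local Open Scope complex_scope.

Set Implicit Arguments.
Unset Strict Implicit.
Unset Printing Implicit Defensive.

Import Order.TTheory GRing.Theory Num.Theory.

(** The off-diagonal entries of the matrix X = X_(a, lambda) live in the block
    M_2(C), while its diagonal entries vanish there, so X^2 is diagonal
    ([frakX_sqr]): its two entries are 1 on the four one-dimensional summands,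
    and diag(-w, w) and diag(w, -w) on the block M_2(C), where w = i a satisfies
    w^2 = -1.  The unimodular number lambda has already disappeared.  Powers of
    X^2 are therefore powers of w, which have period 4, whence the period 8 in
    k.  For odd k the remaining factor X kills the block M_2(C) on the diagonal,
    and the trace does not depend on k ([chi_odd]).  For even k = 2n the trace
    is 2 on the one-dimensional summands and the scalar matrix
    ((-1)^n + 1) w^n on the block ([chi_even]).

    In every case the trace has the form (r1, r2, r3, r4, r I_2) with real r's.
    Such an element is self-adjoint, and the Haar state assigns to its spectral
    projections the weights 1/8, 1/8, 1/8, 1/8 and 1/2; so its distribution is
    the corresponding combination of Dirac masses
    ([spectral_diag_distribution]), which regroups into mu_1, mu_2, mu_4 or
    mu_0. *)

(** * Integration against finite combinations of Dirac masses *)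

Section atomic_integral.
Context d (T : measurableType d) (R : realType).

Lemma ge0_integral_weighted_diracs (s : seq (R * T)) (f : T -> \bar R) :
    all (fun p => 0 <= p.1) s -> measurable_fun setT f ->
    (forall x, 0 <= f x)%E ->
  (\int[weighted_diracs s]_x f x = \sum_(p <- s) p.1%:E * f p.2)%E.
Proof.
move=> s0 mf f0; elim: s s0 => [_|[w x] s IH /= /andP[/= w0 s0]].
  rewrite big_nil.
  have -> : weighted_diracs [::] =
      (mzero : {measure set T -> \bar R}) :> (set T -> \bar R).
    by apply/funext => A; rewrite /weighted_diracs big_nil.
  exact: integral_measure_zero.
(* The induction hypothesis is about a set function; the tail has to be
   repackaged as a measure before additivity in the measure applies. *)
pose m := HB.pack_for {measure set T -> \bar R} (weighted_diracs s)
  (isMeasure.Build _ _ _ (weighted_diracs s) (weighted_diracs0 s)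
    (weighted_diracs_ge0 s0) (weighted_diracs_semi_sigma_additive s0)).
pose w' := NngNum w0.
have -> : weighted_diracs ((w, x) :: s) =
    measure_add (mscale w' (dirac x)) m :> (set T -> \bar R).
  by apply/funext => A; rewrite measure_addE /weighted_diracs big_cons.
rewrite ge0_integral_measure_add// ge0_integral_mscale//.
by rewrite integral_dirac// diracT mul1e [X in (_ + X)%E]IH// big_cons.
Qed.

(* The measure is a variable that agrees with the combination of Dirac masses,
   rather than the combination itself, so that a measure given with another
   list of atoms can be integrated after regrouping them. *)
Variables (s : seq (R * T)) (mu : {measure set T -> \bar R}).
Hypotheses (s0 : all (fun p => 0 <= p.1) s) (mus : mu =1 weighted_diracs s).

Lemma ge0_integral_atomic (g : T -> R) : measurable_fun setT g ->
    (forall x, 0 <= g x) ->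
  (\int[mu]_x (g x)%:E = (\sum_(p <- s) p.1 * g p.2)%:E)%E.
Proof.
move=> mg g0; have -> : (mu : set T -> \bar R) = weighted_diracs s by exact/funext.
rewrite ge0_integral_weighted_diracs//; last exact/(measurable_EFinP _ g).
by rewrite -sumEFin.
Qed.

Variables (f : T -> R) (mf : measurable_fun setT f).

Lemma integrable_atomic : mu.-integrable setT (EFin \o f).
Proof.
apply/integrableP; split; first exact/measurable_EFinP.
rewrite ge0_integral_atomic ?ltry//.
exact: measurableT_comp.
Qed.

Lemma Rintegral_atomic :
  (\int[mu]_(x in setT) f x)%R = \sum_(p <- s) p.1 * f p.2.
Proof.
rewrite /Rintegral integralE funerpos funerneg.
rewrite ge0_integral_atomic; [|exact: measurable_funrpos|exact: funrpos_ge0].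
rewrite ge0_integral_atomic; [|exact: measurable_funrneg|exact: funrneg_ge0].
rewrite -EFinB/= -sumrB; apply: eq_bigr => p _.
by rewrite -mulrBr -[in RHS](funrposBneg f).
Qed.

End atomic_integral.

(** * Two-by-two matrices over a ring *)

Section mx2_algebra.
Variable A : nzRingType.
Implicit Types a b c e p q : A.

Lemma mx2M a b c e a' b' c' e' :
  mx2 a b c e * mx2 a' b' c' e' =
  mx2 (a * a' + b * c') (a * b' + b * e') (c * a' + e * c') (c * b' + e * e').
Proof.
apply/matrixP => i j; rewrite !mxE big_ord_recl big_ord1 !mxE /=.
by case: (i == 0); case: (j == 0).
Qed.

Lemma mx2D a b c e a' b' c' e' :
  mx2 a b c e + mx2 a' b' c' e' = mx2 (a + a') (b + b') (c + c') (e + e').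
Proof.
by apply/matrixP => i j; rewrite !mxE; case: (i == 0); case: (j == 0).
Qed.

Lemma mxtrace_mx2 a b c e : \tr (mx2 a b c e) = a + e.
Proof. by rewrite /mxtrace big_ord_recl big_ord1 !mxE. Qed.

Lemma mx2_scalar a : mx2 a 0 0 a = a%:M.
Proof.
apply/matrixP => i j; rewrite !mxE.
by case: i => [[|[|?]] ?]; case: j => [[|[|?]] ?].
Qed.

Lemma mx2_diagX p q n : mx2 p 0 0 q ^+ n = mx2 (p ^+ n) 0 0 (q ^+ n).
Proof.
elim: n => [|n IH]; first by rewrite !expr0 mx2_scalar.
by rewrite !exprS IH mx2M !mulr0 !mul0r !addr0 add0r.
Qed.

End mx2_algebra.

(** * The traces of the powers *)

Section chi.
Variable R : realType.
Local Notation C := R[i].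

Lemma KPalgM (x1 x2 x3 x4 y1 y2 y3 y4 : C) (c e : 'M[C]_2) :
  ((x1, x2, x3, x4, c) : KPalg R) * (y1, y2, y3, y4, e) =
  (x1 * y1, x2 * y2, x3 * y3, x4 * y4, c * e).
Proof. by []. Qed.

Lemma KPalgD (x1 x2 x3 x4 y1 y2 y3 y4 : C) (c e : 'M[C]_2) :
  ((x1, x2, x3, x4, c) : KPalg R) + (y1, y2, y3, y4, e) =
  (x1 + y1, x2 + y2, x3 + y3, x4 + y4, c + e).
Proof. by []. Qed.

Lemma KPalgX (x1 x2 x3 x4 : C) (c : 'M[C]_2) n :
  ((x1, x2, x3, x4, c) : KPalg R) ^+ n =
  (x1 ^+ n, x2 ^+ n, x3 ^+ n, x4 ^+ n, c ^+ n).
Proof. by elim: n => // n IH; rewrite !exprS IH. Qed.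

Variables (a lambda : C).
Hypotheses (ha : a = -1 \/ a = 1) (hlambda : `|lambda| = 1).

Let aa : a * a = 1.
Proof. by case: ha => ->; rewrite ?mulrNN mulr1. Qed.

Let ll : lambda * lambda^* = 1.
Proof. by rewrite -sqr_normc hlambda expr1n. Qed.

Let w : C := 'i * a.

Let ww : w ^+ 2 = -1.
Proof. by rewrite exprMn sqr_i expr2 aa mulr1. Qed.

Definition one_block (c : 'M[C]_2) : KPalg R := (1, 1, 1, 1, c).

(** The off-diagonal entries of the square vanish because each of
    their terms multiplies a diagonal entry by an off-diagonal one, and these
    live on complementary summands of the algebra; in the diagonal entries
    lambda meets its conjugate. *)
Lemma frakX_sqr : frakX a lambda ^+ 2 =
  mx2 (one_block (mx2 (- w) 0 0 w)) 0 0 (one_block (mx2 w 0 0 (- w))).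
Proof.
rewrite expr2 /frakX mx2M !KPalgM !KPalgD !mx2M.
rewrite !(mul0r, mulr0, addr0, add0r, mul1r, mulrN, mulNr, opprK, aa, mulr1).
rewrite -/w.
have -> : lambda * (w * lambda^*) = w by rewrite mulrCA ll mulr1.
have -> : w * lambda * lambda^* = w by rewrite -mulrA ll mulr1.
have -> : lambda^* * (w * lambda) = w by rewrite mulrCA [_^* * _]mulrC ll mulr1.
have -> : w * lambda^* * lambda = w by rewrite -mulrA [_^* * _]mulrC ll mulr1.
by rewrite /one_block.
Qed.

(** The two diagonal entries of the even power differ by the exchange of w and
    -w, hence their blocks add up to a scalar matrix. *)
Lemma chi_even n : \tr (frakX a lambda ^+ n.*2) =
  (2, 2, 2, 2, (((-1) ^+ n + 1) * w ^+ n)%:M) :> KPalg R.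
Proof.
rewrite -mul2n exprM frakX_sqr mx2_diagX mxtrace_mx2 !KPalgX !mx2_diagX.
rewrite KPalgD mx2D !expr1n addr0 (exprNn w) [w ^+ n + _]addrC.
by rewrite mx2_scalar mulrDl mul1r.
Qed.

(** One factor [frakX a lambda] is split off an even power, which is diagonal.
    The block parts of that power, the only ones to depend on n, are multiplied
    by the zero blocks of the entries X_11 and X_22. *)
Lemma chi_odd n : \tr (frakX a lambda ^+ n.*2.+1) = (2, 0, 0, -2, 0) :> KPalg R.
Proof.
rewrite exprS -mul2n exprM frakX_sqr mx2_diagX /frakX mx2M mxtrace_mx2.
rewrite !mulr0 addr0 add0r !KPalgX !KPalgM KPalgD !expr1n !mulr1 !mul0r addr0.
by rewrite subrr addNr -opprD.
Qed.

Let wX_double n : w ^+ n.*2 = (-1) ^+ n.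
Proof. by rewrite -mul2n exprM ww. Qed.

(** The two diagonal entries of the power of w cancel: (-w)^m = - w^m for m odd. *)
Lemma chi_singly_even n :
  \tr (frakX a lambda ^+ n.*2.+1.*2) = (2, 2, 2, 2, 0) :> KPalg R.
Proof.
rewrite chi_even exprS -mul2n exprM sqrrN !expr1n mulr1.
by rewrite addNr mul0r raddf0.
Qed.

Lemma chi_doubly_even n : \tr (frakX a lambda ^+ n.*2.*2) =
  (2, 2, 2, 2, (2 * (-1) ^+ n)%:M) :> KPalg R.
Proof.
by rewrite chi_even wX_double -[in X in X + 1]mul2n exprM sqrrN !expr1n.
Qed.

End chi.

(** * Distributions of elements with scalar blocks *)

Section distribution.
Variable R : realType.
Local Notation C := R[i].
Variables r1 r2 r3 r4 r : R.

Definition spectral_diag : KPalg R := (r1%:C, r2%:C, r3%:C, r4%:C, (r%:C)%:M).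

Lemma spectral_diag_selfadjoint : KPselfadjoint spectral_diag.
Proof.
rewrite /KPselfadjoint /KPstar /spectral_diag !conjc_real; congr (_, _).
apply/matrixP => i j; rewrite !mxE eq_sym.
by case: eqP; rewrite ?conjc_real ?conjc0.
Qed.

Lemma haar_spectral_diagX m : haar (spectral_diag ^+ m) =
  (8^-1 * (r1 ^+ m + r2 ^+ m + r3 ^+ m + r4 ^+ m + 4 * r ^+ m))%:C.
Proof.
rewrite /spectral_diag KPalgX -mx2_scalar mx2_diagX /haar !mxE /=.
rewrite -!rmorphXn /=.
rewrite rmorphM fmorphV !rmorphD rmorphM !rmorph_nat.
by congr (_ * (_ + _)); ring.
Qed.

(** The Haar state of the projection onto a one-dimensional summand is 1/8; that
    of the unit of the block M_2(C) is (2/8) (1 + 1) = 1/2. Repeated eigenvalues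
    are kept as separate atoms. *)
Definition spectral_weights : seq (R * R) :=
  [:: (8^-1, r1); (8^-1, r2); (8^-1, r3); (8^-1, r4); (2^-1, r)].

Lemma spectral_diag_distribution (mu : probability (measurableTypeR R) R) :
    mu =1 @weighted_diracs _ (measurableTypeR R) R spectral_weights ->
  has_star_distribution spectral_diag mu.
Proof.
move=> muE m.
have w0 : all (fun p : R * R => 0 <= p.1) spectral_weights.
  by rewrite /= !invr_ge0 !ler0n.
have mX : measurable_fun setT (fun t : measurableTypeR R => t ^+ m).
  exact: exprn_measurable.
(* The line carries two measurable structures, so the one of [mu] is given
   explicitly. *)
split; first exact: (@integrable_atomic _ (measurableTypeR R) R _ mu w0 muE _ mX).
rewrite (@Rintegral_atomic _ (measurableTypeR R) R _ mu w0 muE _ mX).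
rewrite haar_spectral_diagX !big_cons big_nil /=.
by congr (_%:C); field.
Qed.

End distribution.

(** * The residues of the exponent *)

Lemma mod2_1 k : (k = 1 %[mod 2])%N -> k = k./2.*2.+1.
Proof. by lia. Qed.

Lemma mod4_2 k : (k = 2 %[mod 4])%N -> k = (k %/ 4).*2.+1.*2.
Proof. by lia. Qed.

Lemma mod8_4 k : (k = 4 %[mod 8])%N -> k = (k %/ 8).*2.+1.*2.*2.
Proof. by lia. Qed.

Lemma mod8_0 k : (k = 0 %[mod 8])%N -> k = (k %/ 8).*2.*2.*2.
Proof. by lia. Qed.

Lemma mod_cases k : [\/ (k = 1 %[mod 2])%N, (k = 2 %[mod 4])%N,
  (k = 4 %[mod 8])%N | (k = 0 %[mod 8])%N].
Proof.
have : [|| k %% 2 == 1, k %% 4 == 2, k %% 8 == 4 | k %% 8 == 0]%N by lia.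
by case/or4P => /eqP; [constructor 1|constructor 2|constructor 3|constructor 4].
Qed.

(** * The four measures as spectral combinations *)

Section mu.
Variable R : realType.
Local Notation wd := (@weighted_diracs _ (measurableTypeR R) R).

Lemma mu1_spectral : mu1 R =1 wd (spectral_weights 2 0 0 (-2) 0).
Proof.
move=> A; rewrite /mu1 /weighted_diracs !big_cons big_nil /= !diracE.
by rewrite -!EFinM -!EFinD; congr EFin; lra.
Qed.

Lemma mu2_spectral : mu2 R =1 wd (spectral_weights 2 2 2 2 0).
Proof.
move=> A; rewrite /mu2 /weighted_diracs !big_cons big_nil /= !diracE.
by rewrite -!EFinM -!EFinD; congr EFin; lra.
Qed.

Lemma mu4_spectral : mu4 R =1 wd (spectral_weights 2 2 2 2 (-2)).
Proof.
move=> A; rewrite /mu4 /weighted_diracs !big_cons big_nil /= !diracE.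
by rewrite -!EFinM -!EFinD; congr EFin; lra.
Qed.

Lemma mu0_spectral : mu0 R =1 wd (spectral_weights 2 2 2 2 2).
Proof.
move=> A; rewrite /mu0 /weighted_diracs !big_cons big_nil /= !diracE.
by rewrite -!EFinM -!EFinD; congr EFin; lra.
Qed.

End mu.

(** * Distributions of the traces *)

Theorem theorem2p1 (R : realType) (k : nat) (a lambda : R[i])
    (ha : a = -1 \/ a = 1) (hlambda : `|lambda| = 1) :
  let chi : KPalg R := \tr (frakX a lambda ^+ k) in
  [/\ KPselfadjoint chi,
      [/\ (k = 1 %[mod 2])%N -> has_star_distribution chi (mu1 R),
          (k = 2 %[mod 4])%N -> has_star_distribution chi (mu2 R),
          (k = 4 %[mod 8])%N -> has_star_distribution chi (mu4 R) &
          (k = 0 %[mod 8])%N -> has_star_distribution chi (mu0 R)] &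
      [/\ (k = 1 %[mod 2])%N -> chi = (2, 0, 0, -2, 0),
          (k = 2 %[mod 4])%N -> chi = (2, 2, 2, 2, 0),
          (k = 4 %[mod 8])%N -> chi = (2, 2, 2, 2, (- 2) *: 1%:M) &
          (k = 0 %[mod 8])%N -> chi = (2, 2, 2, 2, 2 *: 1%:M)]].
Proof.
move=> chi.
have real2 : (2 : R)%:C = 2 by rewrite rmorph_nat.
have realN2 : (- 2 : R)%:C = - 2 by rewrite rmorphN /= real2.
have chi1 : (k = 1 %[mod 2])%N -> chi = spectral_diag 2 0 0 (-2) 0.
  move=> /mod2_1 kE; rewrite /chi kE chi_odd//.
  by rewrite /spectral_diag real2 realN2 !raddf0.
have chi2 : (k = 2 %[mod 4])%N -> chi = spectral_diag 2 2 2 2 0.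
  move=> /mod4_2 kE; rewrite /chi kE chi_singly_even//.
  by rewrite /spectral_diag real2 !raddf0.
have chi4 : (k = 4 %[mod 8])%N -> chi = spectral_diag 2 2 2 2 (-2).
  move=> /mod8_4 kE; rewrite /chi kE chi_doubly_even//.
  rewrite /spectral_diag real2 realN2 exprS -mul2n exprM sqrrN !expr1n mulr1.
  by rewrite mulrN1.
have chi0 : (k = 0 %[mod 8])%N -> chi = spectral_diag 2 2 2 2 2.
  move=> /mod8_0 kE; rewrite /chi kE chi_doubly_even//.
  by rewrite /spectral_diag real2 -mul2n exprM sqrrN !expr1n mulr1.
split; first by case: (mod_cases k) => [/chi1|/chi2|/chi4|/chi0] ->;
  exact: spectral_diag_selfadjoint.
- split=> [/chi1|/chi2|/chi4|/chi0] ->; apply: spectral_diag_distribution.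
  + exact: mu1_spectral.
  + exact: mu2_spectral.
  + exact: mu4_spectral.
  + exact: mu0_spectral.
- split=> [/chi1|/chi2|/chi4|/chi0] ->;
    by rewrite /spectral_diag ?scalemx1 ?real2 ?realN2 ?raddf0.
Qed.
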